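(* Let $K\subset\mathbb{R}^n$ be open and non-empty. Then there exist non-trivial smooth polynomially bounded $\mathbb{R}^n$-actions on $\mathbb{R}^n$ with support in $K$; that is, there exist a compact set $K'\subset K$, a sequence $\boldsymbol b=\{b_l\}_{l\in\mathbb{N}_0}$ of non-negative numbers with $b_0=0$, and a smooth $\mathbb{R}^n$-action $\tau$ on $\mathbb{R}^n$ with support in $K'$ and order $\boldsymbol b$, such that $\tau_x(y)\neq y$ for some $x,y\in\mathbb{R}^n$.
   Context: Let $K'\subset\mathbb{R}^n$ be compact and let $\boldsymbol b=\{b_l\}_{l\in\mathbb{N}_0}$ be a sequence of non-negative real numbers with $b_0=0$. A smooth $\mathbb{R}^n$-action (on $\mathbb{R}^n$) with support in $K'$ and order $\boldsymbol b$ is a smooth function $\tau\colon\mathbb{R}^n\times\mathbb{R}^n\to\mathbb{R}^n$, $(x,y)\mapsto\tau_x(y)$, such that (1) $\tau_x(\tau_{x'}(y))=\tau_{x+x'}(y)$ for all $x,x',y\in\mathbb{R}^n$; (2) $\tau_x(y)=y$ for all $x\in\mathbb{R}^n$ and all $y\in\mathbb{R}^n\setminus K'$; (3) for each $\mu\in\mathbb{N}_0^n$, $l\in\mathbb{N}_0$ there is a constant $c_{l\mu}>0$ such that for all $x\in\mathbb{R}^n$ $$\sup_{y\in K',\ |\nu|\le l,\ j\in\{1,\dots,n\}}|\partial_y^\nu\partial_x^\mu\tau_x(y)_j|\le c_{l\mu}(1+\|x\|^2)^{\frac12b_l}.$$ (As an action, $\tau_0=\mathrm{id}$.) *)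

(* Defs.v *)
From HB Require Import structures.
From mathcomp Require Import all_boot all_order all_algebra.
From mathcomp Require Import all_classical all_reals all_analysis.
Set Implicit Arguments.
Unset Strict Implicit.
Unset Printing Implicit Defensive.
Import Order.TTheory GRing.Theory Num.Theory.
Import numFieldNormedType.Exports.
Local Open Scope classical_set_scope.
Local Open Scope ring_scope.

(* The library norm on 'rV[R]_n is the sup norm, so the Euclidean one is
   defined here; the topology on 'rV[R]_n is the usual one either way. *)
Definition enorm (R : realType) (n : nat) (x : 'rV[R]_n) : R :=
  Num.sqrt (\sum_(i < n) x ord0 i ^+ 2).

Definition iterD (R : realType) (V W : normedModType R) (s : seq V)
    (f : V -> W) : V -> W :=
  foldr (fun v g => fun p => 'D_v g p) f s.

(* C^infinity on finite-dimensional V: every iterated directional derivative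
   exists and is Frechet differentiable (in particular continuous). As 'D_v
   is total, it carries its usual meaning here because the requirement on s
   makes the derivatives indexed by v :: s exist. *)
Definition smooth (R : realType) (V W : normedModType R) (f : V -> W) : Prop :=
  forall (s : seq V) (p : V), differentiable (iterD s f) p.

Definition multi_index (n : nat) := {ffun 'I_n -> nat}.

Definition order_mi (n : nat) (mu : multi_index n) : nat :=
  (\sum_(i < n) mu i)%N.

(* The directions of d^mu along the vectors e: each e i is listed mu i times. *)
Definition mi_dirs (R : realType) (V : normedModType R) (n : nat)
    (e : 'I_n -> V) (mu : multi_index n) : seq V :=
  flatten [seq nseq (mu i) (e i) | i <- enum 'I_n].

Definition dirx (R : realType) (n : nat) (i : 'I_n) : 'rV[R]_n * 'rV[R]_n :=
  (delta_mx ord0 i, 0).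

Definition diry (R : realType) (n : nat) (i : 'I_n) : 'rV[R]_n * 'rV[R]_n :=
  (0, delta_mx ord0 i).

(* d_y^nu d_x^mu tau, evaluated at (x, y). *)
Definition dydx (R : realType) (n : nat)
    (tau : 'rV[R]_n -> 'rV[R]_n -> 'rV[R]_n) (nu mu : multi_index n)
    (x y : 'rV[R]_n) : 'rV[R]_n :=
  iterD (mi_dirs (@diry R n) nu)
    (iterD (mi_dirs (@dirx R n) mu) (fun p => tau p.1 p.2)) (x, y).

Record smooth_action (R : realType) (n : nat) (K' : set 'rV[R]_n)
    (b : nat -> R) (tau : 'rV[R]_n -> 'rV[R]_n -> 'rV[R]_n) : Prop := {
  action_smooth : smooth (fun p : 'rV[R]_n * 'rV[R]_n => tau p.1 p.2);
  action_id : forall y, tau 0 y = y;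
  action_comp : forall x x' y, tau x (tau x' y) = tau (x + x') y;
  action_support : forall x y, ~ K' y -> tau x y = y;
  action_bound : forall (mu : multi_index n) (l : nat),
    exists2 c : R, 0 < c & forall x : 'rV[R]_n,
      (ereal_sup [set z : \bar R | exists (y : 'rV[R]_n)
                    (nu : multi_index n) (j : 'I_n),
         [/\ K' y, (order_mi nu <= l)%N
           & z = (`|dydx tau nu mu x y ord0 j|)%:E]]
       <= (c * (1 + enorm x ^+ 2) `^ (2^-1 * b l))%:E)%E }.

(* Main.v *)
(** The action translates one coordinate along the orbits of a complete vector
    field that is flat at the two ends of an interval, with a speed depending
    on the other coordinates.

    In one dimension the flow on ]-pi/2, pi/2[ is conjugated to a translation
    of the line: for u = tan s it moves sinh u to sinh u + t. As 1/cosh u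
    decays faster than any power of u while ds/du = 1/(1 + u^2), the velocity
    is flat at the end points. All derivatives of the flow are sums of terms
    g(u) ch(u)^k h(U) ch(U)^-(k+e), U being the image of u under the flow and
    g, h having polynomial growth; here k counts the derivatives in s. Since
    ch u <= 2 (1 + |t|) ch U, such a term is O((1 + |t|)^(k+1) / (1 + u^2)) for
    e >= 1, which gives at once the polynomial bound and the vanishing to
    second order at the end points that makes the extension by 0 smooth.
    Pure s-derivatives only have e = 0; they are recovered from their value
    at t = 0 by the mean value theorem in t.

    The action itself is y |-> y + r disp(x_i0 cutoff(rho y), s) e_i0, where s is
    the rescaled coordinate i0 and rho the sum of the squares of the others;
    cutoff is the velocity of the flow, itself a bump function. *)
From HB Require Import structures.
Require Import Defs.
From mathcomp Require Import all_boot all_order all_algebra.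
From mathcomp Require Import all_classical all_reals all_analysis.
From mathcomp Require Import ring lra zify.
Set Implicit Arguments.
Unset Strict Implicit.
Unset Printing Implicit Defensive.
Import Order.TTheory GRing.Theory Num.Theory.
Import numFieldNormedType.Exports.
Local Open Scope classical_set_scope.
Local Open Scope ring_scope.

(* [iterD] alone would denote a lemma of [ssrnat]. *)
Local Notation iterD := Defs.iterD.

(** * Hyperbolic functions and symbols *)
Section hyperbolic.
Context {R : realType}.
Implicit Types u w t : R.

Definition ch u : R := (expR u + expR (- u)) / 2.
Definition sh u : R := (expR u - expR (- u)) / 2.
Definition th u : R := sh u / ch u.
Definition arsh w : R := ln (w + Num.sqrt (w ^+ 2 + 1)).

Lemma ch_gt0 u : 0 < ch u.
Proof. by rewrite divr_gt0// addr_gt0// expR_gt0. Qed.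

Lemma ch_neq0 u : ch u != 0. Proof. by rewrite gt_eqF// ch_gt0. Qed.

Lemma ch2 u : ch u ^+ 2 = 1 + sh u ^+ 2.
Proof.
rewrite /ch /sh expRN; have := expR_gt0 u; set e := expR u => e0.
by field; rewrite gt_eqF.
Qed.

Lemma ch_ge1 u : 1 <= ch u.
Proof.
rewrite -(@ler_pXn2r _ 2) ?nnegrE ?(ltW (ch_gt0 _))//.
by rewrite ch2 expr1n lerDl sqr_ge0.
Qed.

Lemma norm_sh_le u : `|sh u| <= ch u.
Proof.
rewrite -(@ler_pXn2r _ 2) ?nnegrE ?(ltW (ch_gt0 _))//.
by rewrite real_normK ?num_real// ch2 lerDr.
Qed.

Lemma norm_th_le u : `|th u| <= 1.
Proof.
by rewrite normrM normfV (gtr0_norm (ch_gt0 u)) ler_pdivrMr ?ch_gt0// mul1r norm_sh_le.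
Qed.

Lemma is_derive_expRN u : is_derive u 1 (fun v : R => expR (- v)) (- expR (- u)).
Proof.
have H : is_derive u (1 : R) (fun v : R => - v) (-1).
  exact: is_deriveN.
have := @is_derive1_comp R expR (fun v : R => - v) u _ _ (is_derive_expR (- u)) H.
by move/is_derive_eq; apply; rewrite mulrN1.
Qed.

Lemma is_derive_ch u : is_derive u 1 ch (sh u).
Proof.
have H := is_deriveD (is_derive_expR u) (is_derive_expRN u).
have := is_deriveZ (2^-1) H.
rewrite (_ : 2^-1 \*: _ = ch); last first.
  by apply/funext => v; rewrite /ch /= /GRing.scale /= mulrC.
by move/is_derive_eq; apply; rewrite /sh /GRing.scale /= mulrC.
Qed.

Lemma is_derive_sh u : is_derive u 1 sh (ch u).
Proof.
have H := is_deriveB (is_derive_expR u) (is_derive_expRN u).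
have := is_deriveZ (2^-1) H.
rewrite (_ : 2^-1 \*: _ = sh); last first.
  by apply/funext => v; rewrite /sh /= /GRing.scale /= mulrC.
by move/is_derive_eq; apply; rewrite /ch /GRing.scale /= mulrC opprK.
Qed.

Lemma is_derive_th u : is_derive u 1 th (1 - th u ^+ 2).
Proof.
have H := is_deriveM (is_derive_sh u) (is_deriveV (ch_neq0 u) (is_derive_ch u)).
apply: is_derive_eq H _.
rewrite /GRing.scale /= /th; have := ch_neq0 u => ?.
by field.
Qed.

Lemma arshK w : sh (arsh w) = w.
Proof.
have h : 0 < w + Num.sqrt (w ^+ 2 + 1).
  have : `|w| < Num.sqrt (w ^+ 2 + 1).
    by rewrite -sqrtr_sqr ltr_sqrt ?ltrDl// ltr_wpDl// sqr_ge0.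
  by rewrite ltr_norml => /andP[]; lra.
rewrite /sh /arsh expRN lnK ?posrE//.
have : Num.sqrt (w ^+ 2 + 1) ^+ 2 = w ^+ 2 + 1.
  by rewrite sqr_sqrtr// addr_ge0// sqr_ge0.
set q := Num.sqrt _ in h * => q2.
apply: (@mulIf _ (2 * (w + q))); first by rewrite mulf_neq0// gt_eqF.
transitivity ((w + q) ^+ 2 - 1); first by field; rewrite gt_eqF.
by transitivity (w ^+ 2 + 2 * w * q + q ^+ 2 - 1); [ring|rewrite q2; ring].
Qed.

Lemma shK u : arsh (sh u) = u.
Proof.
rewrite /arsh (_ : sh u ^+ 2 + 1 = ch u ^+ 2); last by rewrite ch2 addrC.
rewrite sqrtr_sqr gtr0_norm ?ch_gt0// (_ : sh u + ch u = expR u) ?expRK//.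
by rewrite /sh /ch; lra.
Qed.

Lemma is_derive_arsh w : is_derive w 1 arsh (ch (arsh w))^-1.
Proof.
rewrite -{1}(arshK w); apply: (@is_derive_inverse R sh).
- by near=> z; exact: shK.
- near=> z; apply: differentiable_continuous; apply/derivable1_diffP.
  by apply: ex_derive; exact: is_derive_sh.
- exact: is_derive_sh.
- exact: ch_neq0.
Unshelve. all: by end_near. Qed.

(** [ch] and [sh] have comparable size, [ch u <= 1 + |sh u|] and [|sh v| <= ch v]. When [v] is the
    image of [u] at time [t], the difference [sh v - sh u] is [t], so [ch] shrinks at most linearly
    in time along an orbit. *)
Lemma ch_shift_le u v : ch u <= 2 * (1 + `|sh v - sh u|) * ch v.
Proof.
have h1 : ch u <= 1 + `|sh u|.
  rewrite -(@ler_pXn2r _ 2) ?nnegrE ?(ltW (ch_gt0 _)) ?addr_ge0//.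
  rewrite ch2 sqrrD expr1n mul1r real_normK ?num_real//.
  by have := normr_ge0 (sh u); lra.
have h2 : `|sh u| <= `|sh v| + `|sh v - sh u|.
  rewrite -[X in `|X| <= _](subKr (sh v)); exact: ler_normB.
have h3 := ch_ge1 v; have h4 := norm_sh_le v.
have h5 := normr_ge0 (sh v - sh u).
nra.
Qed.

(** With [N = 2 i + 1] one has [1 + |u| <= N exp (|u| / N)]; raising this to the power [2 i < N]
    leaves at most [exp |u| <= 2 ch u]. *)
Lemma poly_le_ch i : exists2 K : R, 0 < K & forall u, (1 + u ^+ 2) ^+ i <= K * ch u.
Proof.
pose N : R := (2 * i).+1%:R.
have N0 : 0 < N by rewrite ltr0n.
exists (2 * N ^+ (2 * i)); first by rewrite mulr_gt0// exprn_gt0.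
move=> u.
have h1 : expR `|u| <= 2 * ch u.
  rewrite /ch mulrC divfK//; case: (ger0P u) => _; rewrite ?lerDl ?lerDr expR_ge0//.
apply: (le_trans (y := N ^+ (2 * i) * expR `|u|)); last first.
  by rewrite mulrAC [leRHS]mulrC ler_wpM2l ?exprn_ge0 ?(ltW N0)// [leRHS]mulrC.
have h2 : (1 + u ^+ 2) ^+ i <= (1 + `|u|) ^+ (2 * i).
  rewrite exprM; apply: lerXn2r; rewrite ?nnegrE ?addr_ge0 ?sqr_ge0//.
  rewrite sqrrD expr1n mul1r real_normK ?num_real//.
  by have := normr_ge0 u; lra.
apply: le_trans h2 _.
have h3 : 1 + `|u| <= N * expR (`|u| / N).
  apply: (le_trans (y := N * (1 + `|u| / N))).
    rewrite mulrDr mulr1 mulrCA divff ?mulr1 ?gt_eqF// lerD2r.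
    by rewrite ler1n.
  by rewrite ler_pM2l// expR_ge1Dx.
apply: le_trans (_ : (N * expR (`|u| / N)) ^+ (2 * i) <= _).
  by apply: lerXn2r => //; rewrite nnegrE ?addr_ge0// mulr_ge0 ?expR_ge0 ?ltW.
rewrite exprMn ler_wpM2l ?exprn_ge0 ?(ltW N0)//.
rewrite -expRM_natl ler_expR mulrA mulrAC ler_piMl// ler_pdivrMr// mul1r.
by rewrite ler_nat.
Qed.

(** A class of functions of polynomial growth that is closed under differentiation. The generator
    [(1 + u^2)^-1] comes from the derivative of [atan], and [th] from the logarithmic derivative of
    [ch]. *)
Inductive symb : (R -> R) -> Prop :=
| symb_cst c : symb (cst c)
| symb_id : symb id
| symb_inv : symb (fun u => (1 + u ^+ 2)^-1)
| symb_th : symb th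
| symb_add g h : symb g -> symb h -> symb (fun u => g u + h u)
| symb_mul g h : symb g -> symb h -> symb (fun u => g u * h u).

Lemma oneDsqr_neq0 u : 1 + u ^+ 2 != 0.
Proof. by rewrite gt_eqF// ltr_pwDl// sqr_ge0. Qed.

Lemma symb_sqr : symb (fun u => 1 + u ^+ 2).
Proof. exact: (symb_add (symb_cst 1) (symb_mul symb_id symb_id)). Qed.

Lemma is_derive_oneDsqr u : is_derive u 1 (fun v : R => 1 + v ^+ 2) (2 * u).
Proof.
have H := is_deriveD (is_derive_cst (1 : R) u 1) (is_deriveX 2 (is_derive_id u (1 : R))).
apply: is_derive_eq H _.
by rewrite /GRing.scale /= add0r expr1 mulr1.
Qed.

Lemma symb_derive g : symb g ->
  exists2 g', symb g' & forall u, is_derive u 1 g (g' u).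
Proof.
elim=> [c||||g1 g2 _ [d1 s1 D1] _ [d2 s2 D2]|g1 g2 S1 [d1 s1 D1] S2 [d2 s2 D2]].
- by exists (cst 0); [exact: symb_cst|move=> u; exact: is_derive_cst].
- by exists (cst 1); [exact: symb_cst|move=> u; exact: is_derive_id].
- exists (fun u => (-2 * u) * ((1 + u ^+ 2)^-1 * (1 + u ^+ 2)^-1)).
    exact: (symb_mul (symb_mul (symb_cst (-2)) symb_id) (symb_mul symb_inv symb_inv)).
  move=> u; have := is_deriveV (f := fun v : R => 1 + v ^+ 2) (oneDsqr_neq0 u) (is_derive_oneDsqr u).
  move/is_derive_eq; apply; rewrite /GRing.scale /=.
  by field; have := oneDsqr_neq0 u; rewrite expr2.
- exists (fun u => 1 + -1 * (th u * th u)).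
    exact: (symb_add (symb_cst 1) (symb_mul (symb_cst (-1)) (symb_mul symb_th symb_th))).
  by move=> u; apply: is_derive_eq (is_derive_th u) _; rewrite mulN1r expr2.
- exists (fun u => d1 u + d2 u); first exact: symb_add.
  by move=> u; exact: (is_deriveD (D1 u) (D2 u)).
- exists (fun u => g1 u * d2 u + g2 u * d1 u).
    by apply: symb_add; apply: symb_mul.
  by move=> u; exact: (is_deriveM (D1 u) (D2 u)).
Qed.

Lemma symb_poly_bound g : symb g ->
  exists i, exists2 K : R, 0 < K & forall u, `|g u| <= K * (1 + u ^+ 2) ^+ i.
Proof.
have p1 u i : 1 <= (1 + u ^+ 2) ^+ i by rewrite exprn_ege1// lerDl sqr_ge0.
elim=> [c||||g1 g2 _ [i1 [K1 K10 B1]] _ [i2 [K2 K20 B2]]|g1 g2 _ [i1 [K1 K10 B1]] _ [i2 [K2 K20 B2]]].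
- exists 0%N, (`|c| + 1); first by rewrite ltr_wpDl.
  by move=> u; rewrite expr0 mulr1 lerDl.
- exists 1%N, 1 => // u; rewrite mul1r expr1 -(real_normK (num_real u)).
  by have := sqr_ge0 (`|u| - 2^-1); lra.
- exists 0%N, 1 => // u; rewrite expr0 mulr1 ger0_norm ?invr_ge0 ?addr_ge0 ?sqr_ge0//.
  by rewrite invf_le1 ?lerDl ?sqr_ge0// ltr_pwDl// sqr_ge0.
- by exists 0%N, 1 => // u; rewrite expr0 mulr1; exact: norm_th_le.
- exists (i1 + i2)%N, (K1 + K2); first exact: addr_gt0.
  move=> u; apply: le_trans (ler_normD _ _) _; rewrite mulrDl exprD.
  apply: lerD.
    apply: le_trans (B1 u) _; rewrite ler_pM2l// ler_peMr//.
    by rewrite (le_trans ler01).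
  apply: le_trans (B2 u) _; rewrite ler_pM2l// ler_peMl//.
  by rewrite (le_trans ler01).
- exists (i1 + i2)%N, (K1 * K2); first exact: mulr_gt0.
  by move=> u; rewrite normrM exprD mulrACA ler_pM.
Qed.

(** Bounding the square lets a product of one symbol at [u] and one at its image [U] be controlled
    by [sqrt (ch u * ch U)], hence by a single factor [ch U] up to powers of [1 + |t|]. *)
Lemma symb_sqr_bound g : symb g ->
  exists2 K : R, 0 < K & forall u, g u ^+ 2 <= K * ch u.
Proof.
move=> /symb_poly_bound[i [K K0 B]].
have [L L0 BL] := poly_le_ch (i * 2).
exists (K ^+ 2 * L); first by rewrite mulr_gt0// exprn_gt0.
move=> u; rewrite -(real_normK (num_real (g u))).
apply: le_trans (_ : (K * (1 + u ^+ 2) ^+ i) ^+ 2 <= _).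
  apply: lerXn2r => //; rewrite nnegrE//.
  by rewrite (le_trans _ (B u)).
by rewrite exprMn -exprM -mulrA ler_pM2l ?exprn_gt0// BL.
Qed.

End hyperbolic.

(** * Frechet derivatives of real-valued functions *)
Section differentials.
Context {R : realType} {V : normedModType R}.
Implicit Types (f g : V -> R) (p : V).

Lemma is_diff_intro f p (df : {linear V -> R}) : continuous df ->
  (forall e : R, 0 < e -> \forall h \near (0 : V), `|f (h + p) - (f p + df h)| <= e * `|h|) ->
  is_diff p f df.
Proof.
move=> dfc h; have H : f \o shift p = cst (f p) + df +o_ 0 id.
  by apply/eqaddoP => e e0; exact: h.
have E := diff_unique dfc H.
by constructor => //; apply/diff_locallyP; rewrite E.
Qed.

Lemma is_diff_near f g p df : (\forall q \near p, f q = g q) ->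
  is_diff p f df -> is_diff p g df.
Proof.
move=> fg [fd <-]; apply: is_diff_intro; first exact: diff_continuous.
have /eqaddoP H := diff_locally fd => e e0.
have fgp : f p = g p by exact: nbhs_singleton fg.
have fg0 : \forall h \near (0 : V), f (h + p) = g (h + p).
  by have := fg; rewrite (near_shift 0 p) /= => H1; near=> h; near: h; move: H1; rewrite !near_simpl subr0.
have He := H e e0.
near=> h.
rewrite -(_ : f (h + p) = g (h + p)); last by near: h.
by rewrite -fgp; near: h.
Unshelve. all: by end_near. Qed.

(** At [q = p] the bound forces [f p = 0], and elsewhere it is [o(|q - p|)]. This gives
    differentiability of the extension by zero at the end points of the interval. *)
Lemma is_diff0_quadratic f p (K : R) :
  (\forall q \near p, `|f q| <= K * `|q - p| ^+ 2) -> is_diff p f (fun=> 0).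
Proof.
move=> fK.
have fp : f p = 0.
  have := nbhs_singleton fK; rewrite /= subrr normr0 expr0n mulr0 normr_le0.
  by move/eqP.
apply: (@is_diff_intro f p \0); first exact: cst_continuous.
have fK0 : \forall h \near (0 : V), `|f (h + p)| <= K * `|h| ^+ 2.
  have := fK; rewrite (near_shift 0 p) /= subr0 => H1; near=> h.
  rewrite -[X in K * `|X| ^+ 2](addrK p).
  by near: h.
move=> e e0; near=> h; rewrite fp !add0r subr0.
have h1 : `|f (h + p)| <= K * `|h| ^+ 2 by near: h.
apply: le_trans h1 _; rewrite expr2 mulrA ler_wpM2r//.
apply: le_trans (ler_norm _) _; rewrite normrM normr_id.
have h2 : `|h| <= e / (`|K| + 1).
  near: h; apply: nbhs0_le; rewrite divr_gt0// ltr_wpDl//.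
have h3 : `|K| * `|h| <= `|K| * (e / (`|K| + 1)) by rewrite ler_wpM2l.
apply: le_trans h3 _; rewrite mulrCA ler_piMr ?(ltW e0)//.
by rewrite ler_pdivrMr ?ltr_wpDl// mul1r lerDl.
Unshelve. all: by end_near. Qed.

Lemma is_diff_addf f g p df dg : is_diff p f df -> is_diff p g dg ->
  is_diff p (fun q => f q + g q) (fun v => df v + dg v).
Proof. exact: is_diffD. Qed.

Lemma is_diff_mulf f g p df dg : is_diff p f df -> is_diff p g dg ->
  is_diff p (fun q => f q * g q) (fun v => f p * dg v + g p * df v).
Proof. exact: is_diffM. Qed.

Lemma is_diff_subf f g p df dg : is_diff p f df -> is_diff p g dg ->
  is_diff p (fun q => f q - g q) (fun v => df v - dg v).
Proof. exact: is_diffB. Qed.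

Lemma is_diff_comp1 (phi : R -> R) (d : R) f p df :
  is_derive (f p) 1 phi d -> is_diff p f df ->
  is_diff p (fun q => phi (f q)) (fun v => d * df v).
Proof.
move=> [/derivable1_diffP phid dE] fd.
have H : is_diff (f p) phi (fun h => d * h).
  constructor => //; apply/funext => h.
  rewrite -[h in LHS]mulr1 -[h * 1]/(h *: (1 : R)) linearZ /= -deriveE// dE.
  by rewrite /GRing.scale /= mulrC.
exact: (is_diff_comp fd H).
Qed.

Lemma is_diff_comp2 (F : R -> R -> R) (Ft Fs : R) f g p df dg :
  is_diff (f p, g p) (fun z : R * R => F z.1 z.2) (fun w => Ft * w.1 + Fs * w.2) ->
  is_diff p f df -> is_diff p g dg ->
  is_diff p (fun q => F (f q) (g q)) (fun v => Ft * df v + Fs * dg v).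
Proof. by move=> FD fd gd; exact: (is_diff_comp (is_diff_pair fd gd) FD). Qed.

Lemma is_diff_eqf f p df dg : is_diff p f df -> (forall v, df v = dg v) -> is_diff p f dg.
Proof. by move=> H E; apply: is_diff_eq H _; exact/funext. Qed.

Lemma is_diff_derive f p df v : is_diff p f df -> 'D_v f p = df v.
Proof. by move=> [fd <-]; exact: deriveE. Qed.

End differentials.

(** * Functions of two real variables with explicit partial derivatives *)

Definition is_diff2 {R : realType} (F : R -> R -> R) t s (Ft Fs : R) :=
  is_diff (t, s) (fun z : R * R => F z.1 z.2) (fun w => Ft * w.1 + Fs * w.2).

Section is_diff2.
Context {R : realType}.
Implicit Types (F : R -> R -> R) (t s : R).

Lemma is_diff_fst2 t s : is_diff (t, s) (fun z : R * R => z.1) (fun w => w.1).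
Proof.
apply: (@is_diff_intro _ _ (fun z : R * R => z.1) (t, s) fst).
  by move=> z; exact: cvg_fst.
move=> e e0; near=> h; rewrite /= [h.1 + t]addrC subrr normr0 mulr_ge0//.
exact: ltW.
Unshelve. all: by end_near. Qed.

Lemma is_diff_snd2 t s : is_diff (t, s) (fun z : R * R => z.2) (fun w => w.2).
Proof.
apply: (@is_diff_intro _ _ (fun z : R * R => z.2) (t, s) snd).
  by move=> z; exact: cvg_snd.
move=> e e0; near=> h; rewrite /= [h.2 + s]addrC subrr normr0 mulr_ge0//.
exact: ltW.
Unshelve. all: by end_near. Qed.

Lemma is_diff2_eq F t s Ft Fs Ft' Fs' : is_diff2 F t s Ft Fs ->
  Ft = Ft' -> Fs = Fs' -> is_diff2 F t s Ft' Fs'.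
Proof. by move=> H <- <-. Qed.

Lemma is_diff2_add F G t s Ft Fs Gt Gs : is_diff2 F t s Ft Fs -> is_diff2 G t s Gt Gs ->
  is_diff2 (fun t s => F t s + G t s) t s (Ft + Gt) (Fs + Gs).
Proof.
by move=> H1 H2; apply: is_diff_eqf (is_diff_addf H1 H2) _ => v; ring.
Qed.

Lemma is_diff2_sub F G t s Ft Fs Gt Gs : is_diff2 F t s Ft Fs -> is_diff2 G t s Gt Gs ->
  is_diff2 (fun t s => F t s - G t s) t s (Ft - Gt) (Fs - Gs).
Proof.
by move=> H1 H2; apply: is_diff_eqf (is_diff_subf H1 H2) _ => v; ring.
Qed.

Lemma is_diff2_mul F G t s Ft Fs Gt Gs : is_diff2 F t s Ft Fs -> is_diff2 G t s Gt Gs ->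
  is_diff2 (fun t s => F t s * G t s) t s (F t s * Gt + G t s * Ft) (F t s * Gs + G t s * Fs).
Proof.
by move=> H1 H2; apply: is_diff_eqf (is_diff_mulf H1 H2) _ => v /=; ring.
Qed.

Lemma is_diff2_comp (phi : R -> R) d F t s Ft Fs : is_derive (F t s) 1 phi d ->
  is_diff2 F t s Ft Fs -> is_diff2 (fun t s => phi (F t s)) t s (d * Ft) (d * Fs).
Proof.
move=> H1 H2.
have H := @is_diff_comp1 _ _ phi d (fun z : R * R => F z.1 z.2) (t, s) _ H1 H2.
by apply: is_diff_eqf H _ => v /=; ring.
Qed.

Lemma is_diff2_snd (phi : R -> R) d t s : is_derive s 1 phi d ->
  is_diff2 (fun _ s => phi s) t s 0 d.
Proof.
move=> H; apply: is_diff_eqf (is_diff_comp1 (p := (t, s)) H (is_diff_snd2 t s)) _.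
by move=> v /=; ring.
Qed.

Lemma is_diff2_fst t s : is_diff2 (fun t _ => t) t s 1 0.
Proof. by apply: is_diff_eqf (is_diff_fst2 t s) _ => v /=; ring. Qed.

Lemma is_diff2_derive_t F t s Ft Fs : is_diff2 F t s Ft Fs ->
  is_derive t 1 (F ^~ s) Ft.
Proof.
move=> H.
have H2 := is_diff_comp2 (p := t) H (@is_diff_id R R t) (is_diff_cst s t).
have [d E] := is_diff_eqf H2 (dg := fun v => Ft * v) (fun v => ltac:(by rewrite /= mulr0 addr0)).
split; first exact/derivable1_diffP.
by rewrite deriveE// E mulr1.
Qed.

Lemma is_diff2_derive_s F t s Ft Fs : is_diff2 F t s Ft Fs ->
  is_derive s 1 (F t) Fs.
Proof.
move=> H.
have H2 := is_diff_comp2 (p := s) H (is_diff_cst t s) (@is_diff_id R R s).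
have [d E] := is_diff_eqf H2 (dg := fun v => Fs * v) (fun v => ltac:(by rewrite /= mulr0 add0r)).
split; first exact/derivable1_diffP.
by rewrite deriveE// E mulr1.
Qed.

(** Mean value theorem between 0 and [t]. The intermediate point is only known to be closer to 0
    than [t], hence the monotonicity of [B] in [|t|]. *)
Lemma le_deriv_t F Ft (B : R -> R) s t : F 0 s = 0 ->
  (forall t, is_derive t 1 (F ^~ s) (Ft t)) ->
  (forall t t', `|t| <= `|t'| -> B t <= B t') ->
  (forall t, `|Ft t| <= B t) -> `|F t s| <= B t * `|t|.
Proof.
move=> F0 FD Bm FB.
have cF a b : {within `[a, b], continuous (F ^~ s)}.
  apply: derivable_within_continuous => x _; by case: (FD x).
have [t0|t0|->] := ltgtP t 0.
- have [c] := MVT t0 (fun x _ => FD x) (cF t 0).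
  rewrite in_itv /= => /andP[tc c0]; rewrite F0 sub0r.
  move/(congr1 (fun x => `|x|)); rewrite normrN normrM sub0r normrN => ->.
  rewrite ler_wpM2r//; apply: le_trans (FB c) _; apply: Bm.
  by rewrite (ltr0_norm c0) (ltr0_norm t0) lerN2 ltW.
- have [c] := MVT t0 (fun x _ => FD x) (cF 0 t).
  rewrite in_itv /= => /andP[c0 tc]; rewrite F0 subr0.
  move/(congr1 (fun x => `|x|)); rewrite normrM subr0 => ->.
  rewrite ler_wpM2r//; apply: le_trans (FB c) _; apply: Bm.
  by rewrite (gtr0_norm c0) (gtr0_norm t0) ltW.
- by rewrite F0 normr0 mulr0.
Qed.

End is_diff2.

(** * The flow in the coordinate u = tan s *)
Section flow_coordinates.
Context {R : realType}.
Implicit Types (t u : R) (g h : R -> R) (F : R -> R -> R).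

Definition hflow t u : R := arsh (sh u + t).

Lemma hflow0 u : hflow 0 u = u.
Proof. by rewrite /hflow addr0 shK. Qed.

Lemma hflowD t t' u : hflow t (hflow t' u) = hflow (t + t') u.
Proof. by rewrite /hflow arshK -addrA (addrC t'). Qed.

Lemma is_diff2_hflow t u :
  is_diff2 hflow t u (ch (hflow t u))^-1 (ch u / ch (hflow t u)).
Proof.
have H := is_diff2_add (is_diff2_snd t (is_derive_sh u)) (is_diff2_fst t u).
have := is_diff2_comp (F := fun t u => sh u + t) (is_derive_arsh (sh u + t)) H.
by move/is_diff2_eq; apply; rewrite /hflow; ring.
Qed.

Lemma ch_le_hflow t u : ch u <= 2 * (1 + `|t|) * ch (hflow t u).
Proof.
by have := ch_shift_le u (hflow t u); rewrite /hflow arshK addrAC subrr add0r.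
Qed.

(** As [sh = th * ch], differentiating a power of [ch] keeps the exponent and only multiplies by
    [k th], which is absorbed in the symbol. *)
Lemma symb_ch_derive k g : symb g -> exists2 g', symb g' &
  forall u, is_derive u 1 (fun u => g u * ch u ^+ k) (g' u * ch u ^+ k).
Proof.
move=> gS; have [g' g'S gD] := symb_derive gS.
exists (fun u => g' u + k%:R * (g u * th u)).
  apply: symb_add => //; apply: symb_mul (symb_cst _) _.
  by apply: symb_mul => //; exact: symb_th.
move=> u; have H := is_deriveM (gD u) (is_deriveX k (is_derive_ch u)).
rewrite (_ : (fun _ => _) = g * ch ^+ k); last by apply/funext => v; rewrite !fctE.
apply: is_derive_eq H _; rewrite /GRing.scale /= /th fctE.
case: k => [|k] /=; first by rewrite !expr0; ring.
by rewrite exprS; have := ch_neq0 u => ?; field.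
Qed.

Lemma symb_chV_derive k g : symb g -> exists2 g', symb g' &
  forall u, is_derive u 1 (fun u => g u * (ch u)^-1 ^+ k) (g' u * (ch u)^-1 ^+ k).
Proof.
move=> gS; have [g' g'S gD] := symb_derive gS.
exists (fun u => g' u + - k%:R * (g u * th u)).
  apply: symb_add => //; apply: symb_mul (symb_cst _) _.
  by apply: symb_mul => //; exact: symb_th.
move=> u.
have H := is_deriveM (gD u) (is_deriveX k (is_deriveV (ch_neq0 u) (is_derive_ch u))).
rewrite (_ : (fun _ => _) = g * (fun v => (ch v)^-1) ^+ k); last first.
  by apply/funext => v; rewrite !fctE.
apply: is_derive_eq H _; rewrite /GRing.scale /= /th fctE.
case: k => [|k] /=; first by rewrite !expr0; ring.
by rewrite -exprVn (exprS _ k) expr2; ring.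
Qed.

Definition hmono k m g h t u : R :=
  (g u * ch u ^+ k) * (h (hflow t u) * (ch (hflow t u))^-1 ^+ m).

(* d/ds = (1 + u^2) d/du raises [k] by one and d/dt raises [e] by one. *)
Inductive hsymb : nat -> nat -> (R -> R -> R) -> Prop :=
| hsymb_mono k e g h : symb g -> symb h -> hsymb k e (hmono k (k + e) g h)
| hsymb_add k e F G : hsymb k e F -> hsymb k e G -> hsymb k e (fun t u => F t u + G t u)
| hsymb_succ k e F : hsymb k e F -> hsymb k.+1 e F.

(** The time acts only through the image [U], with [dU/dt = 1 / ch U]: one more inverse power of
    [ch U]. In [u] the product rule gives two terms: differentiating [g ch^k] keeps both exponents,
    while [dU/du = ch u / ch U] raises both by one. The factor [1 + u^2] turning [d/du] into [d/ds]
    is absorbed in [g]. *)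
Lemma hmono_diff k e g h : symb g -> symb h -> exists h' Fs,
  [/\ symb h', hsymb k.+1 e Fs & forall t u, is_diff2 (hmono k (k + e) g h) t u
    (hmono k (k + e).+1 g h' t u) (Fs t u / (1 + u ^+ 2))].
Proof.
move=> gS hS.
have [g' g'S gD] := symb_ch_derive k gS.
have [h' h'S hD] := symb_chV_derive (k + e) hS.
exists h'.
exists (fun t u => hmono k (k + e) (fun u => g' u * (1 + u ^+ 2)) h t u +
         hmono k.+1 (k + e).+1 (fun u => g u * (1 + u ^+ 2)) h' t u).
split => // [|t u].
  apply: hsymb_add; first apply: hsymb_succ; apply: hsymb_mono => //;
    apply: symb_mul => //; exact: symb_sqr.
have H := is_diff2_mul (is_diff2_snd t (gD u)) (is_diff2_comp (hD (hflow t u)) (is_diff2_hflow t u)).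
apply: is_diff2_eq H _ _; rewrite /hmono !(exprS _ (k + e)) ?(exprS _ k) /=; first by ring.
move: (oneDsqr_neq0 u); set d := 1 + u ^+ 2 => d0.
by apply: (mulIf d0); rewrite mulfVK//; ring.
Qed.

Lemma hsymb_diff k e F : hsymb k e F -> exists Ft Fs,
  [/\ hsymb k e.+1 Ft, hsymb k.+1 e Fs &
   forall t u, is_diff2 F t u (Ft t u) (Fs t u / (1 + u ^+ 2))].
Proof.
elim=> {k e F} [k e g h gS hS|k e F G _ [Ft [Fs [FtS FsS FD]]] _ [Gt [Gs [GtS GsS GD]]]|k e F _ [Ft [Fs [FtS FsS FD]]]].
- have [h' [Fs [h'S FsS D]]] := hmono_diff k e gS hS.
  exists (hmono k (k + e).+1 g h'), Fs; split => //.
  by rewrite -addnS; exact: hsymb_mono.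
- exists (fun t u => Ft t u + Gt t u), (fun t u => Fs t u + Gs t u).
  split; [exact: hsymb_add|exact: hsymb_add|move=> t u].
  by apply: is_diff2_eq (is_diff2_add (FD t u) (GD t u)) _ _; rewrite ?mulrDl.
- by exists Ft, Fs; split => //; exact: hsymb_succ.
Qed.

(** For [u = tan s] the factor [1 / (1 + u^2)] is [cos s ^ 2], so this is vanishing to second order
    at the ends of the interval in [s], with a constant of polynomial growth in [t]. *)
Definition flat N F := exists2 K : R, 0 < K &
  forall t u, `|F t u| <= K * (1 + `|t|) ^+ N / (1 + u ^+ 2).

Lemma flatD N F G : flat N F -> flat N G -> flat N (fun t u => F t u + G t u).
Proof.
move=> [K K0 HK] [L L0 HL]; exists (K + L); first exact: addr_gt0.
move=> t u; apply: le_trans (ler_normD _ _) _.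
by rewrite !mulrDl lerD.
Qed.

Lemma oneDnorm_ge1 t : 1 <= 1 + `|t|. Proof. by rewrite lerDl. Qed.

Lemma oneDsqr_gt0 u : 0 < 1 + u ^+ 2. Proof. by rewrite ltr_pwDl// sqr_ge0. Qed.

Lemma flatS N F : flat N F -> flat N.+1 F.
Proof.
move=> [K K0 HK]; exists K => // t u; apply: le_trans (HK t u) _.
rewrite ler_wpM2r ?invr_ge0 ?(ltW (oneDsqr_gt0 u))// ler_pM2l//.
by rewrite exprS ler_peMl ?oneDnorm_ge1// exprn_ge0// addr_ge0.
Qed.

(** Put [T = 1 + |t|]. One factor [1 / ch U] pays for both symbols and for [1 + u^2], at the cost of
    one [T]; the [k] quotients [ch u / ch U] cost [2 T] each; the remaining [e] factors [1 / ch U]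
    are at most 1. *)
Lemma hmono_flat k e g h : symb g -> symb h -> flat k.+1 (hmono k (k + e).+1 g h).
Proof.
move=> gS hS.
have [K1 K10 B1] := symb_sqr_bound (symb_mul gS symb_sqr).
have [K2 K20 B2] := symb_sqr_bound hS.
(* The estimate [XY] is proved by comparing squares, which asks for [2 * K1 * K2 <= K ^+ 2]. *)
pose K := 1 + 2 * K1 * K2.
have K0 : 0 < K by rewrite addr_gt0 ?mulr_gt0.
exists (K * 2 ^+ k); first by rewrite mulr_gt0// exprn_gt0.
move=> t u; rewrite ler_pdivlMr ?oneDsqr_gt0//.
rewrite -[X in _ * X](gtr0_norm (oneDsqr_gt0 u)) -normrM.
set U := hflow t u.
have c1 := ch_ge1 u; have C1 := ch_ge1 U.
have c0 := ch_gt0 u; have C0 := ch_gt0 U.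
have cC : ch u <= 2 * (1 + `|t|) * ch U := ch_le_hflow t u.
have T1 := oneDnorm_ge1 t.
set T := 1 + `|t| in cC T1 *.
have T0 : 0 < T by rewrite (lt_le_trans ltr01).
have XY : `|g u * (1 + u ^+ 2) * h U| <= K * T * ch U.
  rewrite -(@ler_pXn2r _ 2) ?nnegrE// ?mulr_ge0 ?(ltW K0) ?(ltW T0) ?(ltW C0)//.
  rewrite real_normK ?num_real// exprMn.
  apply: (le_trans (y := (K1 * ch u) * (K2 * ch U))).
    by rewrite ler_pM ?sqr_ge0.
  apply: (le_trans (y := (K1 * (2 * T * ch U)) * (K2 * ch U))).
    by rewrite (ler_pM2r (mulr_gt0 K20 C0)) (ler_pM2l K10).
  rewrite (_ : _ * _ * (_ * _) = (2 * K1 * K2) * (T * ch U ^+ 2)); last by ring.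
  rewrite (_ : (_ * _ * _) ^+ 2 = (K ^+ 2 * T) * (T * ch U ^+ 2)); last by ring.
  rewrite ler_wpM2r ?mulr_ge0 ?sqr_ge0 ?(ltW T0)//.
  have KK : 2 * K1 * K2 <= K ^+ 2.
    have p : 0 < K1 * K2 by rewrite mulr_gt0.
    by rewrite /K; nra.
  by rewrite (le_trans KK)// ler_peMr// sqr_ge0.
rewrite (_ : hmono k (k + e).+1 g h t u * (1 + u ^+ 2) =
   (g u * (1 + u ^+ 2) * h U) * (ch U)^-1 * (ch u / ch U) ^+ k * (ch U)^-1 ^+ e); last first.
  rewrite /hmono -/U (exprS _ (k + e)) exprD (exprMn k (ch u)).
  by ring.
have Ce : 0 <= (ch U)^-1 ^+ e <= 1.
  by rewrite exprn_ge0 ?invr_ge0 ?(ltW C0)//= exprn_ile1 ?invr_ge0 ?(ltW C0)// invf_le1.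
have /andP[q0 q1] : 0 <= (ch u / ch U) ^+ k <= (2 * T) ^+ k.
  rewrite exprn_ge0 ?divr_ge0 ?(ltW c0) ?(ltW C0)//=; apply: lerXn2r.
  - by rewrite nnegrE divr_ge0 ?(ltW c0) ?(ltW C0).
  - by rewrite nnegrE mulr_ge0// ltW.
  - by rewrite ler_pdivrMr.
have Ci : 0 <= (ch U)^-1 by rewrite invr_ge0 (ltW C0).
have /andP[e0 e1] := Ce.
rewrite !normrM (ger0_norm q0) (ger0_norm Ci) (ger0_norm e0) -!normrM.
apply: (le_trans (y := K * T * (2 * T) ^+ k * 1)); last first.
  by rewrite exprMn exprS; rewrite le_eqVlt; apply/orP; left; apply/eqP; ring.
apply: ler_pM => //.
  by rewrite !mulr_ge0.
apply: ler_pM => //.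
  by rewrite mulr_ge0.
by rewrite ler_pdivrMr.
Qed.

Lemma hsymb_flat k e F : hsymb k e F -> (0 < e)%N -> flat k.+1 F.
Proof.
elim=> {k e F} [k [//|e] g h gS hS _|k e F G _ IF _ IG e0|k e F _ IF e0].
- by rewrite addnS; exact: hmono_flat.
- by apply: flatD; [exact: IF|exact: IG].
- by apply: flatS; exact: IF.
Qed.

(** Going from time 0 to [t] costs a factor [|t| <= 1 + |t|], hence the exponent [N.+1]; the decay
    in [u] is inherited, [u] being a parameter. *)
Lemma flat_deriv_t N F Ft : (forall u, F 0 u = 0) ->
  (forall t u, is_derive t 1 (F ^~ u) (Ft t u)) -> flat N Ft -> flat N.+1 F.
Proof.
move=> F0 FD [K K0 HK]; exists K => // t u.
have u0 := oneDsqr_gt0 u.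
pose B t := K * (1 + `|t|) ^+ N / (1 + u ^+ 2).
have := @le_deriv_t R F (Ft ^~ u) B u t (F0 u) (fun t => FD t u) _ (fun t => HK t u).
have Bm t1 t2 : `|t1| <= `|t2| -> B t1 <= B t2.
  move=> t12; rewrite /B ler_pM2r ?invr_gt0// ler_pM2l//.
  by apply: lerXn2r; rewrite ?nnegrE ?addr_ge0// lerD2l.
move/(_ Bm)/le_trans; apply; rewrite /B mulrAC ler_pM2r ?invr_gt0//.
by rewrite exprSr mulrA ler_wpM2l ?lerDr// mulr_ge0 ?(ltW K0)// exprn_ge0// addr_ge0.
Qed.

End flow_coordinates.

(** * The flow on the line *)
Section flow.
Context {R : realType}.
Implicit Types (t s u : R) (g h : R -> R) (F : R -> R -> R).

Definition ext F t s : R := if `|s| < pi / 2 then F t (tan s) else 0.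

Lemma ext_in F t s : `|s| < pi / 2 -> ext F t s = F t (tan s).
Proof. by rewrite /ext => ->. Qed.

Lemma ext_out F t s : pi / 2 <= `|s| -> ext F t s = 0.
Proof. by rewrite /ext ltNge => ->. Qed.

Lemma cos_gt0_norm s : `|s| < pi / 2 -> 0 < cos s.
Proof. by rewrite ltr_norml => /cos_gt0_pihalf. Qed.

Lemma oneDtan2 s : `|s| < pi / 2 -> (1 + tan s ^+ 2)^-1 = cos s ^+ 2.
Proof.
by move=> /cos_gt0_norm/lt0r_neq0 c0; rewrite -cos2_tan2// invrK.
Qed.

Lemma norm_sin_le s : `|sin s| <= `|s|.
Proof.
rewrite -[leRHS]mul1r.
have D t : is_derive t 1 (@sin R) (cos t) by exact: is_derive_sin.
have := @le_deriv_t R (fun t _ => sin t) (@cos R) (fun=> 1) 0 s (sin0 R) D.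
by apply => //; exact: cos_max.
Qed.

(** [cos s] is the sine of [pi / 2 - |s|]. The decay [cos s ^ 2] of flat functions thus becomes
    quadratic in the distance to the end points. *)
Lemma cos_le_dist s : `|s| < pi / 2 -> cos s <= pi / 2 - `|s|.
Proof.
move=> sp; rewrite -cos_norm -[X in cos X](subKr (pi / 2)) cosB cos_pihalf sin_pihalf.
rewrite mul0r add0r mul1r; apply: le_trans (ler_norm _) _.
by apply: le_trans (norm_sin_le _) _; rewrite gtr0_norm// subr_gt0.
Qed.

(** Inside the interval this is the chain rule, where [tan' = 1 + tan^2] cancels the denominator. At
    the end points and beyond, flatness of [F] bounds the extension by a multiple of the squared
    distance, so its differential is zero. *)
Lemma ext_diff N F Ft Fs :
  (forall t u, is_diff2 F t u (Ft t u) (Fs t u / (1 + u ^+ 2))) -> flat N F ->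
  forall t s, is_diff2 (ext F) t s (ext Ft t s) (ext Fs t s).
Proof.
move=> FD [K K0 FK] t s; have [sp|sp] := ltP `|s| (pi / 2).
- have H : is_diff (t, s) (fun z : R * R => F z.1 (tan z.2))
      (fun w => ext Ft t s * w.1 + ext Fs t s * w.2).
    have c0 := lt0r_neq0 (cos_gt0_norm sp).
    have Htan := is_diff_comp1 (p := (t, s)) (is_derive_tan c0) (is_diff_snd2 t s).
    have := is_diff_comp2 (p := (t, s)) (FD t (tan s)) (is_diff_fst2 t s) Htan.
    move/is_diff_eqf; apply => w; rewrite !ext_in// oneDtan2//.
    have c2 : cos s ^+ 2 * (cos s) ^- 2 = 1 by rewrite mulfV// expf_neq0.
    by rewrite -[Fs t (tan s) in RHS]mulr1 -c2; ring.
  apply: is_diff_near H.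
  have : \forall z \near (t, s), `|z.2| < pi / 2.
    have : (fun z : R * R => `|z.2|) z @[z --> (t, s)] --> `|s|.
      by apply: cvg_norm; exact: cvg_snd.
    move/cvgr_lt; exact.
  by apply: filterS => z zp; rewrite ext_in.
- rewrite /is_diff2 !ext_out//.
  apply: (is_diff_eqf (df := fun=> 0)); last by move=> v; rewrite !mul0r addr0.
  (* The constant must serve for all nearby times [z.1], and these satisfy
     [1 + |z.1| <= 2 + |t|]. *)
  apply: (is_diff0_quadratic (K := K * (2 + `|t|) ^+ N)).
  have : \forall z \near (t, s), `|z.1| < 1 + `|t|.
    have : (fun z : R * R => `|z.1|) z @[z --> (t, s)] --> `|t|.
      by apply: cvg_norm; exact: cvg_fst.
    by move/cvgr_lt; apply; rewrite ltrDr.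
  apply: filterS => z z1.
  have KN : 0 <= K * (2 + `|t|) ^+ N.
    by rewrite mulr_ge0 ?(ltW K0)// exprn_ge0// addr_ge0.
  have [zp|zp] := ltP `|z.2| (pi / 2); last first.
    by rewrite ext_out// normr0 mulr_ge0// sqr_ge0.
  rewrite ext_in//; apply: le_trans (FK _ _) _; rewrite oneDtan2//.
  apply: ler_pM.
  + by rewrite mulr_ge0 ?(ltW K0)// exprn_ge0// addr_ge0.
  + exact: sqr_ge0.
  + rewrite ler_pM2l//; apply: lerXn2r; rewrite ?nnegrE ?addr_ge0//.
    by have := ltW z1; lra.
  + apply: lerXn2r; rewrite ?nnegrE ?(ltW (cos_gt0_norm zp))//.
    (* Since [pi / 2 <= |s|], the distance [pi / 2 - |z.2|] is at most [|s| - |z.2|]. *)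
    apply: le_trans (cos_le_dist zp) _.
    apply: (le_trans (y := `|s - z.2|)).
      by apply: le_trans (lerB_dist _ _); rewrite lerD2r.
    by rewrite distrC prod_normE /= le_max lexx orbT.
Qed.

Definition hdisp t u : R := atan (hflow t u) - atan u.

(** The time derivative [1 / ((1 + U^2) ch U)] of [hdisp], with [U = hflow t u]; at [t = 0] it is
    the velocity field. *)
Definition hspeed : R -> R -> R := hmono 0 1 (cst 1) (fun u => (1 + u ^+ 2)^-1).

Lemma hdisp_diff : exists2 Fs, hsymb 1 0 Fs &
  forall t u, is_diff2 hdisp t u (hspeed t u) (Fs t u / (1 + u ^+ 2)).
Proof.
(* The first summand is the [s]-derivative of [atan U], the second that of [- s]. *)
exists (fun t u => hmono 1 1 (fun u => 1 + u ^+ 2) (fun u => (1 + u ^+ 2)^-1) t u +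
                   hmono 0 0 (cst (-1)) (cst 1) t u).
  apply: hsymb_add; first exact: hsymb_mono symb_sqr symb_inv.
  by apply: hsymb_succ; exact: hsymb_mono (symb_cst _) (symb_cst _).
move=> t u.
have H := is_diff2_sub (is_diff2_comp (is_derive1_atan (hflow t u)) (is_diff2_hflow t u))
  (is_diff2_snd t (is_derive1_atan u)).
apply: is_diff2_eq H _ _; rewrite /hspeed /hmono /= ?expr0 ?expr1; first by ring.
move: (oneDsqr_neq0 u); set d := 1 + u ^+ 2 => d0.
by apply: (mulIf d0); rewrite mulfVK// mulrBl mulVf//; ring.
Qed.

Lemma hdisp0 u : hdisp 0 u = 0.
Proof. by rewrite /hdisp hflow0 subrr. Qed.

(* Partial derivatives of the displacement, graded by the order in [s]. The
   constructors for order 0 are separate because those derivatives must be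
   bounded uniformly in [t] (this gives b_0 = 0), whereas elements of
   [hsymb 0 1] may grow with [u]. *)
Inductive flowd : nat -> (R -> R -> R) -> Prop :=
| flowd_disp : flowd 0 (ext hdisp)
| flowd_t e h : symb h -> flowd 0 (ext (hmono 0 e.+1 (cst 1) h))
| flowd_ts k e F : hsymb k.+1 e.+1 F -> flowd k.+1 (ext F)
| flowd_s k F : hsymb k.+1 0 F -> (forall u, F 0 u = 0) -> flowd k.+1 (ext F).

Lemma vanish_deriv_s F t s Ft Fs : is_diff2 F t s Ft Fs ->
  (forall u, F t u = 0) -> Fs = 0.
Proof.
move=> /is_diff2_derive_s[_ <-] F0.
by rewrite (_ : F t = cst 0) ?derive_cst//; exact/funext.
Qed.

(** For [e = 0] there is no spare factor [1 / ch U], but the [t]-derivative has one and is flat with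
    exponent [k.+1]; integrating it from time 0 adds one more power. *)
Lemma hsymb_flat0 k F : hsymb k 0 F -> (forall u, F 0 u = 0) -> flat k.+2 F.
Proof.
move=> /hsymb_diff[Ft [Fs [FtS _ FD]]] F0.
apply: (flat_deriv_t F0 (Ft := Ft)); last exact: hsymb_flat FtS _.
by move=> t u; exact: is_diff2_derive_t (FD t u).
Qed.

Lemma hdisp_flat : flat 2 hdisp.
Proof.
have [Fs _ FD] := hdisp_diff.
apply: (flat_deriv_t hdisp0 (Ft := hspeed)).
  by move=> t u; exact: is_diff2_derive_t (FD t u).
exact: (@hmono_flat _ 0 0 _ _ (symb_cst _) symb_inv).
Qed.

(** A [t]-derivative makes [e] positive and falls under [flowd_t] or [flowd_ts]. An [s]-derivative
    of a function with [e] positive falls under [flowd_ts]; of the displacement or of a pure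
    [s]-derivative it still vanishes at time 0 and falls under [flowd_s]. *)
Lemma flowd_diff k F : flowd k F -> exists Ft Fs,
  [/\ flowd k Ft, flowd k.+1 Fs & forall t s, is_diff2 F t s (Ft t s) (Fs t s)].
Proof.
case=> {k F} [|e h hS|k e F FS|k F FS F0].
- have [Fs FsS FD] := hdisp_diff.
  exists (ext hspeed), (ext Fs); split.
  + exact: flowd_t symb_inv.
  + apply: flowd_s => // u.
    have /eqP := vanish_deriv_s (FD 0 u) hdisp0.
    by rewrite mulf_eq0 invr_eq0 (negbTE (oneDsqr_neq0 _)) orbF => /eqP.
  + exact: ext_diff FD hdisp_flat.
- have [h' [Fs [h'S FsS FD]]] := @hmono_diff R 0 e.+1 _ _ (symb_cst 1) hS.
  exists (ext (hmono 0 e.+2 (cst 1) h')), (ext Fs); split.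
  + exact: flowd_t.
  + exact: flowd_ts FsS.
  + exact: ext_diff FD (@hmono_flat R 0 e _ _ (symb_cst 1) hS).
- have [Ft [Fs [FtS FsS FD]]] := hsymb_diff FS.
  exists (ext Ft), (ext Fs); split; [exact: flowd_ts FtS|exact: flowd_ts FsS|].
  exact: ext_diff FD (hsymb_flat FS _).
- have [Ft [Fs [FtS FsS FD]]] := hsymb_diff FS.
  exists (ext Ft), (ext Fs); split; first exact: flowd_ts FtS.
    apply: flowd_s => // u.
    have /eqP := vanish_deriv_s (FD 0 u) F0.
    by rewrite mulf_eq0 invr_eq0 (negbTE (oneDsqr_neq0 _)) orbF => /eqP.
  exact: ext_diff FD (hsymb_flat0 FS F0).
Qed.

Lemma flat_ext_bound N M F : flat N F -> (N <= M)%N ->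
  exists2 K : R, 0 < K & forall t s, `|ext F t s| <= K * (1 + `|t|) ^+ M.
Proof.
move=> [K K0 FK] NM; exists K => // t s.
have [sp|sp] := ltP `|s| (pi / 2); last first.
  by rewrite ext_out// normr0 mulr_ge0 ?(ltW K0)// exprn_ge0// addr_ge0.
rewrite ext_in//; apply: le_trans (FK _ _) _.
rewrite ler_pdivrMr ?oneDsqr_gt0// -[leLHS]mulr1; apply: ler_pM => //.
- by rewrite mulr_ge0 ?(ltW K0)// exprn_ge0// addr_ge0.
- by rewrite ler_pM2l// ler_weXn2l// oneDnorm_ge1.
- by rewrite lerDl sqr_ge0.
Qed.

(** The exponent [3 * k] is linear, so that it adds up in products, is 0 for [k = 0], and dominates
    the exponents [k + 1] and [k + 2] given by flatness when [k > 0]. For [k = 0], the displacement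
    is a difference of two values of [atan], and [h U / ch U] is bounded because
    [h U ^ 2 <= K ch U]. *)
Lemma flowd_bound k F : flowd k F ->
  exists2 K : R, 0 < K & forall t s, `|F t s| <= K * (1 + `|t|) ^+ (3 * k).
Proof.
case=> {k F} [|e h hS|k e F FS|k F FS F0].
- exists pi; first exact: pi_gt0.
  move=> t s; rewrite muln0 expr0 mulr1.
  have [sp|sp] := ltP `|s| (pi / 2); last by rewrite ext_out// normr0 pi_ge0.
  rewrite ext_in// /hdisp; apply: le_trans (ler_normB _ _) _.
  rewrite [leRHS](splitr pi) lerD// ltW// ltr_norml.
    by rewrite atan_gtNpi2 atan_ltpi2.
  by rewrite atan_gtNpi2 atan_ltpi2.
- have [K K0 hK] := symb_sqr_bound hS.
  exists (1 + K); first by rewrite addr_gt0.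
  move=> t s; rewrite muln0 expr0 mulr1.
  have [sp|sp] := ltP `|s| (pi / 2); last by rewrite ext_out// normr0 addr_ge0 ?ltW.
  rewrite ext_in// /hmono expr0 mulr1 mul1r.
  set U := hflow _ _; have C1 := ch_ge1 U; have C0 := ch_gt0 U.
  have Ci : 0 <= (ch U)^-1 by rewrite invr_ge0 ltW.
  rewrite exprSr mulrA normrM (ger0_norm Ci) ler_pdivrMr//.
  rewrite normrM (ger0_norm (exprn_ge0 _ Ci)).
  apply: (le_trans (y := `|h U|)).
    by rewrite ler_piMr// exprn_ile1// invf_le1.
  rewrite -(@ler_pXn2r _ 2) ?nnegrE// ?mulr_ge0 ?addr_ge0 ?(ltW K0) ?(ltW C0)//.
  rewrite real_normK ?num_real//; apply: le_trans (hK U) _.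
  rewrite exprMn; apply: ler_pM; rewrite ?(ltW K0) ?(ltW C0)//.
    by nra.
  by rewrite expr2 ler_peMr// ltW.
- by apply: flat_ext_bound (hsymb_flat FS _) _ => //; rewrite mulnS; lia.
- by apply: flat_ext_bound (hsymb_flat0 FS F0) _; rewrite mulnS; lia.
Qed.

Definition disp : R -> R -> R := ext hdisp.

Definition cutoff s : R := ext hspeed 0 s.

Lemma disp0 s : disp 0 s = 0.
Proof. by rewrite /disp /ext hdisp0 if_same. Qed.

Lemma disp_out t s : pi / 2 <= `|s| -> disp t s = 0.
Proof. exact: ext_out. Qed.

Lemma cutoff_out s : pi / 2 <= `|s| -> cutoff s = 0.
Proof. exact: ext_out. Qed.

(** Inside the interval [s + disp t s] is [atan (hflow t (tan s))], so this is the group law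
    [hflowD]; outside, every term is zero. *)
Lemma dispD t t' s : disp t' s + disp t (s + disp t' s) = disp (t + t') s.
Proof.
have [sp|sp] := ltP `|s| (pi / 2); last by rewrite !(disp_out _ sp) addr0 disp_out// addr0.
have E t1 : s + disp t1 s = atan (hflow t1 (tan s)).
  rewrite /disp ext_in// /hdisp tanK; last by rewrite in_itv /= -ltr_norml.
  by rewrite addrC subrK.
apply: (addrI s); rewrite addrA !E.
have p2 : `|atan (hflow t' (tan s))| < pi / 2.
  by rewrite ltr_norml atan_gtNpi2 atan_ltpi2.
by rewrite /disp ext_in// /hdisp atanK addrC subrK hflowD.
Qed.

Lemma cutoff0 : cutoff 0 = 1.
Proof.
have p2 : `|0 : R| < pi / 2 by rewrite normr0 divr_gt0// pi_gt0.
rewrite /cutoff ext_in// /hspeed /hmono tan0 hflow0 /ch oppr0 expR0 expr0 expr1 expr0n.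
by rewrite /= addr0 divff ?invr1 ?mulr1// (_ : 1 + 1 = 2).
Qed.

Lemma disp10 : disp 1 0 != 0.
Proof.
have p2 : `|0 : R| < pi / 2 by rewrite normr0 divr_gt0// pi_gt0.
rewrite /disp ext_in// /hdisp tan0 atan0 subr0; apply/eqP => /(congr1 tan).
rewrite atanK tan0 => /(congr1 sh); rewrite arshK /sh oppr0 expR0 subrr mul0r add0r.
by move/eqP; rewrite oner_eq0.
Qed.

End flow.

(** * The action *)
Section iterated_derivatives.
Context {R : realType} {V : normedModType R}.

Lemma iterD_cat (W : normedModType R) (s1 s2 : seq V) (f : V -> W) :
  iterD (s1 ++ s2) f = iterD s1 (iterD s2 f).
Proof. exact: foldr_cat. Qed.

Lemma is_diff_sumf (I : Type) (r : seq I) (P : pred I) (f df : I -> V -> R) (p : V) :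
  (forall i, is_diff p (f i) (df i)) ->
  is_diff p (fun q => \sum_(i <- r | P i) f i q) (fun v => \sum_(i <- r | P i) df i v).
Proof.
move=> fD; elim: r => [|i r IH].
  rewrite (_ : (fun q => _) = cst 0); last by apply/funext => q; rewrite big_nil.
  apply: (is_diff_eqf (is_diff_cst 0 p)) => v; by rewrite big_nil.
rewrite (_ : (fun q => _) = fun q => (if P i then f i q else 0) + \sum_(j <- r | P j) f j q); last first.
  by apply/funext => q; rewrite big_cons; case: (P i); rewrite ?add0r.
have H : is_diff p (fun q => if P i then f i q else 0) (fun v => if P i then df i v else 0).
  by case: (P i) => //; exact: is_diff_cst.
apply: is_diff_eqf (is_diff_addf H IH) _ => v.
by rewrite big_cons; case: (P i); rewrite ?add0r.
Qed.

Lemma differentiable_rV n (G : V -> 'rV[R]_n) p :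
  (forall j, differentiable (fun q => G q ord0 j) p) -> differentiable G p.
Proof.
move=> GD; rewrite (_ : G = \sum_(j < n) (fun q => G q ord0 j *: delta_mx ord0 j)).
  by apply: differentiable_sum => j; exact: differentiableZl.
by apply/funext => q; rewrite fct_sumE [LHS]row_sum_delta.
Qed.

(** The two claims are proved together: taking coordinates commutes with the next derivative once
    the vector-valued map is differentiable, and that in turn is read off its coordinates. *)
Lemma iterD_coord n (G : V -> 'rV[R]_n) :
  (forall j s p, differentiable (iterD s (fun q => G q ord0 j)) p) ->
  forall s, (forall p j, iterD s G p ord0 j = iterD s (fun q => G q ord0 j) p) /\
            (forall p, differentiable (iterD s G) p).
Proof.
move=> GD; elim=> [|v s [IH1 IH2]].
  by split=> // p; apply: differentiable_rV => j; exact: (GD j [::]).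
have E p j : iterD (v :: s) G p ord0 j = iterD (v :: s) (fun q => G q ord0 j) p.
  rewrite /= derive_mx; last exact: diff_derivable.
  by rewrite mxE; congr ('D_v _ p); apply/funext => q; exact: IH1.
split=> // p; apply: differentiable_rV => j.
rewrite (_ : (fun q => _) = iterD (v :: s) (fun q => G q ord0 j)) ?GD//.
by apply/funext => q; exact: E.
Qed.

Definition mi_seq n (mu : multi_index n) : seq 'I_n :=
  flatten [seq nseq (mu i) i | i <- enum 'I_n].

Lemma mi_dirsE n (e : 'I_n -> V) (mu : multi_index n) : mi_dirs e mu = map e (mi_seq mu).
Proof.
rewrite /mi_dirs /mi_seq map_flatten -[in RHS]map_comp; congr flatten.
by apply: eq_map => i /=; rewrite map_nseq.
Qed.

Lemma size_mi_seq n (mu : multi_index n) : size (mi_seq mu) = order_mi mu.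
Proof.
rewrite size_flatten /shape -map_comp sumnE big_map big_enum /order_mi.
by apply: eq_bigr => i _; rewrite /= size_nseq.
Qed.

End iterated_derivatives.

(** * Construction of the action and the algebra of its derivatives *)

Section action.
Context {R : realType} {n : nat} (y0 : 'rV[R]_n) (r : R) (i0 : 'I_n).
Hypothesis r_gt0 : 0 < r.
Local Notation V := ('rV[R]_n * 'rV[R]_n)%type.
Implicit Types (p v : V) (f g : V -> R).

Definition ycoord i p : R := (p.2 ord0 i - y0 ord0 i) / r.

Definition rho p : R := \sum_(i < n | i != i0) ycoord i p ^+ 2.

Definition time p : R := p.1 ord0 i0 * cutoff (rho p).

Definition action (x y : 'rV[R]_n) : 'rV[R]_n :=
  y + (r * disp (time (x, y)) (ycoord i0 (x, y))) *: delta_mx ord0 i0.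

(* The grade bounds the growth in [x]: differentiating in [x] preserves it,
   differentiating in [y] raises it by at most one. *)
Inductive tame : nat -> (V -> R) -> Prop :=
| tame_flow k F : flowd k F -> tame k (fun p => F (time p) (ycoord i0 p))
| tame_cutoff k F : flowd k F -> tame 0 (fun p => F 0 (rho p))
| tame_x : tame 1 (fun p => p.1 ord0 i0)
| tame_y i : tame 0 (ycoord i)
| tame_cst c : tame 0 (cst c)
| tame_add l f g : tame l f -> tame l g -> tame l (fun p => f p + g p)
| tame_mul k l f g : tame k f -> tame l g -> tame (k + l) (fun p => f p * g p)
| tame_succ l f : tame l f -> tame l.+1 f.

Lemma tame_scale c l f : tame l f -> tame l (fun p => c * f p).
Proof. exact: tame_mul (tame_cst c). Qed.

Lemma tame_sum (I : Type) (s : seq I) (P : pred I) (f : I -> V -> R) :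
  (forall i, tame 0 (f i)) -> tame 0 (fun p => \sum_(i <- s | P i) f i p).
Proof.
move=> fT; elim: s => [|i s IH].
  rewrite (_ : (fun p => _) = cst 0); first exact: tame_cst.
  by apply/funext => p; rewrite big_nil.
rewrite (_ : (fun p => _) = if P i then (fun p => f i p + \sum_(i <- s | P i) f i p) else fun p => \sum_(i <- s | P i) f i p).
  by case: (P i) => //; exact: tame_add.
by apply/funext => p; rewrite big_cons; case: (P i).
Qed.

Lemma is_diff_fstcoord p i : is_diff p (fun q : V => q.1 ord0 i) (fun v => v.1 ord0 i).
Proof.
have L : linear (fun q : V => q.1 ord0 i : R) by move=> k a b; rewrite /= !mxE.
pose LM := GRing.isLinear.Build _ _ _ _ _ L.
pose F : {linear V -> R} := HB.pack (fun q : V => q.1 ord0 i : R) LM.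
apply: (@is_diff_intro _ _ (fun q : V => q.1 ord0 i) p F).
  move=> q; apply: (continuous_comp (f := fst) (g := fun M : 'rV[R]_n => M ord0 i)).
    exact: cvg_fst.
  exact: coord_continuous.
move=> e e0; near=> h; rewrite /= !mxE [h.1 _ _ + _]addrC subrr normr0 mulr_ge0//.
exact: ltW.
Unshelve. all: by end_near. Qed.

Lemma is_diff_sndcoord p i : is_diff p (fun q : V => q.2 ord0 i) (fun v => v.2 ord0 i).
Proof.
have L : linear (fun q : V => q.2 ord0 i : R) by move=> k a b; rewrite /= !mxE.
pose LM := GRing.isLinear.Build _ _ _ _ _ L.
pose F : {linear V -> R} := HB.pack (fun q : V => q.2 ord0 i : R) LM.
apply: (@is_diff_intro _ _ (fun q : V => q.2 ord0 i) p F).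
  move=> q; apply: (continuous_comp (f := snd) (g := fun M : 'rV[R]_n => M ord0 i)).
    exact: cvg_snd.
  exact: coord_continuous.
move=> e e0; near=> h; rewrite /= !mxE [h.2 _ _ + _]addrC subrr normr0 mulr_ge0//.
exact: ltW.
Unshelve. all: by end_near. Qed.

Lemma is_diff_ycoord p i : is_diff p (ycoord i) (fun v => v.2 ord0 i / r).
Proof.
have H := is_diff_mulf (is_diff_subf (is_diff_sndcoord p i) (is_diff_cst (y0 ord0 i) p))
  (is_diff_cst r^-1 p).
by apply: is_diff_eqf H _ => v /=; rewrite mulr0 add0r subr0 mulrC.
Qed.

Definition drho p v : R := \sum_(i < n | i != i0) ((2 / r * v.2 ord0 i) * ycoord i p).

Lemma is_diff_rho p : is_diff p rho (drho p).
Proof.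
have H i : is_diff p (fun q => ycoord i q ^+ 2) (fun v => (2 / r * v.2 ord0 i) * ycoord i p).
  have H0 := is_diff_mulf (is_diff_ycoord p i) (is_diff_ycoord p i).
  by apply: (is_diff_eqf (f := fun q => ycoord i q ^+ 2) H0) => v; ring.
exact: is_diff_sumf.
Qed.

Lemma tame_drho v : tame 0 (drho ^~ v).
Proof. by apply: tame_sum => i; exact: tame_scale (tame_y i). Qed.

Lemma drho_x p v : v.2 = 0 -> drho p v = 0.
Proof.
by move=> v0; rewrite /drho big1// => i _; rewrite v0 mxE mulr0 mul0r.
Qed.

Lemma flowd_hspeed : flowd 0 (ext (@hspeed R)).
Proof. exact: flowd_t symb_inv. Qed.

(** [cutoff] is the speed [ext hspeed] at time 0, so its derivative [B 0] comes from
    [flowd_diff]. *)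
Lemma is_diff_time : exists2 B, flowd 1 B & forall p, is_diff p time
  (fun v => v.1 ord0 i0 * cutoff (rho p) + p.1 ord0 i0 * (B 0 (rho p) * drho p v)).
Proof.
have [Bt [B [_ BS BD]]] := flowd_diff flowd_hspeed.
exists B => // p.
have H1 := is_diff_comp1 (is_diff2_derive_s (BD 0 (rho p))) (is_diff_rho p).
have H := is_diff_mulf (is_diff_fstcoord p i0) H1.
by apply: is_diff_eqf H _ => v; rewrite addrC /cutoff; congr (_ + _); rewrite mulrC.
Qed.

(** The decisive case is [tame_flow]. In a [y] direction, the derivative of [time] brings out a
    factor [x_i0], of grade 1, and the derivative in the moved coordinate raises [k] by one. In an
    [x] direction only [Ft] times a [cutoff] survives, at the same grade. *)
Lemma tame_diff l f : tame l f -> exists2 df : V -> V -> R,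
  forall p, is_diff p f (df p) &
  forall v, tame l.+1 (df ^~ v) /\ (v.2 = 0 -> tame l (df ^~ v)).
Proof.
elim=> {l f} [k F FS|k F FS||i|c|l f g fT [df fD dfT] gT [dg gD dgT]|k l f g fT [df fD dfT] gT [dg gD dgT]|l f fT [df fD dfT]].
- have [Ft [Fs [FtS FsS FD]]] := flowd_diff FS.
  have [B BS TD] := is_diff_time.
  exists (fun p v => Ft (time p) (ycoord i0 p) *
      (v.1 ord0 i0 * cutoff (rho p) + p.1 ord0 i0 * (B 0 (rho p) * drho p v)) +
      Fs (time p) (ycoord i0 p) * (v.2 ord0 i0 / r)).
    by move=> p; exact: is_diff_comp2 (FD _ _) (TD p) (is_diff_ycoord p i0).
  have T1 v : tame 0 (fun p => v.1 ord0 i0 * cutoff (rho p)).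
    exact: tame_scale (tame_cutoff flowd_hspeed).
  move=> v; split.
    apply: tame_add.
      rewrite -addn1; apply: tame_mul (tame_flow FtS) _.
      apply: tame_add; first exact: tame_succ.
      exact: tame_mul tame_x (tame_mul (tame_cutoff BS) (tame_drho v)).
    rewrite -[k.+1]addn0; exact: tame_mul (tame_flow FsS) (tame_cst _).
  move=> v0.
  rewrite (_ : (fun p => _) = fun p => Ft (time p) (ycoord i0 p) * (v.1 ord0 i0 * cutoff (rho p))).
    by rewrite -[k]addn0; exact: tame_mul (tame_flow FtS) (T1 v).
  by apply/funext => p; rewrite drho_x// v0 mxE mul0r !mulr0 !addr0.
- have [Ft [Fs [FtS FsS FD]]] := flowd_diff FS.
  exists (fun p v => Fs 0 (rho p) * drho p v).
    by move=> p; exact: is_diff_comp1 (is_diff2_derive_s (FD 0 (rho p))) (is_diff_rho p).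
  have T v : tame 0 (fun p => Fs 0 (rho p) * drho p v).
    exact: tame_mul (tame_cutoff FsS) (tame_drho v).
  by move=> v; split => //; exact: tame_succ.
- exists (fun p v => v.1 ord0 i0); first by move=> p; exact: is_diff_fstcoord.
  by move=> v; split=> [|_]; do ?apply: tame_succ; exact: tame_cst.
- exists (fun p v => v.2 ord0 i / r); first by move=> p; exact: is_diff_ycoord.
  by move=> v; split=> [|_]; do ?apply: tame_succ; exact: tame_cst.
- exists (fun p v => 0); first by move=> p; exact: is_diff_cst.
  by move=> v; split=> [|_]; do ?apply: tame_succ; exact: tame_cst.
- exists (fun p v => df p v + dg p v); first by move=> p; exact: is_diff_addf.
  move=> v; have [d1 d2] := dfT v; have [e1 e2] := dgT v.
  by split => [|v0]; apply: tame_add; auto.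
- exists (fun p v => f p * dg p v + g p * df p v); first by move=> p; exact: is_diff_mulf.
  move=> v; have [d1 d2] := dfT v; have [e1 e2] := dgT v.
  split => [|v0]; apply: tame_add.
  + by rewrite -addnS; exact: tame_mul.
  + by rewrite -addSn addnC; exact: tame_mul.
  + by apply: tame_mul => //; exact: e2.
  + by rewrite addnC; apply: tame_mul => //; exact: d2.
- exists df => // v; have [d1 d2] := dfT v.
  by split=> [|v0]; apply: tame_succ; auto.
Qed.

Lemma tame_differentiable l f p : tame l f -> differentiable f p.
Proof. by case/tame_diff => df fD _; have [] := fD p. Qed.

Lemma tame_D l f v : tame l f ->
  tame l.+1 (fun p => 'D_v f p) /\ (v.2 = 0 -> tame l (fun p => 'D_v f p)).
Proof.
case/tame_diff => df fD /(_ v); rewrite (_ : (fun p => 'D_v f p) = df ^~ v)//.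
by apply/funext => p; exact: is_diff_derive.
Qed.

Lemma tame_iterD l f s : tame l f -> tame (size s + l) (iterD s f).
Proof. by move=> fT; elim: s => //= v s IH; have [] := tame_D v IH. Qed.

Lemma tame_iterDx l f s : tame l f -> all (fun v : V => v.2 == 0) s -> tame l (iterD s f).
Proof.
move=> fT; elim: s => //= v s IH /andP[/eqP v0 /IH sT].
by have [_] := tame_D v sT; apply.
Qed.

(** * Polynomial bounds over a compact box *)

Definition box : set 'rV[R]_n := [set y | forall i, `|y ord0 i - y0 ord0 i| <= 2 * r].

Lemma ycoord_box p i : box p.2 -> `|ycoord i p| <= 2.
Proof.
by move=> /(_ i) pb; rewrite normrM normfV (gtr0_norm r_gt0) ler_pdivrMr.
Qed.

(** Since [cutoff] is bounded, [|time|] is at most a multiple of [|x_i0|], which turns growth in the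
    flow time into growth in [x]. The box bounds the coordinates [ycoord i]. *)
Lemma tame_bound l f : tame l f -> exists2 K : R, 0 < K &
  forall p, box p.2 -> `|f p| <= K * (1 + `|p.1 ord0 i0|) ^+ (3 * l).
Proof.
have x1 p : 1 <= 1 + `|p.1 ord0 i0| by exact: oneDnorm_ge1.
have x0 p k : 0 <= (1 + `|p.1 ord0 i0|) ^+ k by rewrite exprn_ge0// addr_ge0.
elim=> {l f} [k F FS|k F FS||i|c|l f g fT [K K0 fK] gT [L L0 gL]|k l f g fT [K K0 fK] gT [L L0 gL]|l f fT [K K0 fK]].
- have [K K0 FK] := flowd_bound FS; have [B B0 bB] := flowd_bound flowd_hspeed.
  exists (K * (1 + B) ^+ (3 * k)); first by rewrite mulr_gt0// exprn_gt0// addr_gt0.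
  move=> p _; apply: le_trans (FK _ _) _.
  rewrite -mulrA ler_pM2l// -exprMn; apply: lerXn2r; rewrite ?nnegrE ?addr_ge0//.
    by rewrite mulr_ge0 ?addr_ge0 ?(ltW B0).
  have : `|time p| <= `|p.1 ord0 i0| * B.
    rewrite normrM ler_wpM2l//; apply: le_trans (bB 0 (rho p)) _.
    by rewrite muln0 expr0 mulr1.
  by have := normr_ge0 (p.1 ord0 i0); nra.
- have [K K0 FK] := flowd_bound FS.
  exists K => // p _; apply: le_trans (FK _ _) _.
  by rewrite muln0 expr0 normr0 addr0 expr1n.
- exists 1 => // p _; rewrite mul1r muln1.
  apply: (le_trans (y := 1 + `|p.1 ord0 i0|)); first by rewrite lerDr.
  by rewrite -[leLHS]expr1 ler_weXn2l.
- by exists 2 => // p pb; rewrite muln0 expr0 mulr1; exact: ycoord_box.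
- exists (1 + `|c|); first by rewrite ltr_pwDl.
  by move=> p _; rewrite muln0 expr0 mulr1 lerDr.
- exists (K + L); first exact: addr_gt0.
  by move=> p pb; apply: le_trans (ler_normD _ _) _; rewrite mulrDl lerD ?fK ?gL.
- exists (K * L); first exact: mulr_gt0.
  by move=> p pb; rewrite normrM mulnDr exprD mulrACA ler_pM ?fK ?gL.
- exists K => // p pb; apply: le_trans (fK p pb) _.
  by rewrite ler_pM2l// ler_weXn2l// mulnS leq_addl.
Qed.

(** One constant has to serve for all lists of length at most [L]. The induction peels off the
    derivative applied first, which is last in the list: it replaces [f] by one of [n] functions of
    grade [l.+1], and the sum of their constants is taken. *)
Lemma tame_iterDy_bound L : forall l f, tame l f -> exists2 K : R, 0 < K &
  forall s : seq 'I_n, (size s <= L)%N -> forall p, box p.2 ->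
  `|iterD (map (@diry R n) s) f p| <= K * (1 + `|p.1 ord0 i0|) ^+ (3 * (L + l)).
Proof.
elim: L => [|L IH] l f fT; have [K K0 fK] := tame_bound fT.
  by exists K => // s; rewrite leqn0 size_eq0 => /eqP-> p pb; exact: fK.
have /choice[C CP] : forall i : 'I_n, exists C : R, 0 < C /\
    forall s : seq 'I_n, (size s <= L)%N -> forall p, box p.2 ->
    `|iterD (map (@diry R n) s) (fun q => 'D_(diry R i) f q) p| <=
      C * (1 + `|p.1 ord0 i0|) ^+ (3 * (L + l.+1)).
  by move=> i; have [fT' _] := tame_D (diry R i) fT; have [C C0 HC] := IH _ _ fT'; exists C.
have S0 : 0 <= \sum_i C i by apply: sumr_ge0 => i _; have [/ltW] := CP i.
exists (K + \sum_i C i); first exact: ltr_pwDl.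
move=> s; case/lastP: s => [_ p pb|s i].
  apply: le_trans (fK p pb) _; apply: ler_pM.
  - exact: ltW.
  - by rewrite exprn_ge0// addr_ge0.
  - by rewrite lerDl.
  - by rewrite ler_weXn2l ?oneDnorm_ge1//; lia.
rewrite size_rcons ltnS => sL p pb; rewrite map_rcons -cats1 iterD_cat.
have [C0 /(_ s sL p pb) HC] := CP i; apply: le_trans HC _.
rewrite addSnnS ler_wpM2r ?exprn_ge0 ?addr_ge0//.
rewrite (bigD1 i)//= addrCA lerDl addr_ge0 ?(ltW K0)//.
by apply: sumr_ge0 => j _; have [/ltW] := CP j.
Qed.

Lemma action_coord j : (fun p : V => action p.1 p.2 ord0 j) =
  fun p => (r * ycoord j p + y0 ord0 j) + (r * (i0 == j)%:R) * disp (time p) (ycoord i0 p).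
Proof.
apply/funext => -[x y] /=; rewrite /action !mxE eqxx /= eq_sym.
have -> : r * ycoord j (x, y) = y ord0 j - y0 ord0 j.
  by rewrite /ycoord mulrC divfK// gt_eqF.
by rewrite subrK mulrAC.
Qed.

Lemma tame_action j : tame 0 (fun p : V => action p.1 p.2 ord0 j).
Proof.
rewrite action_coord; apply: tame_add; first apply: tame_add.
- exact: tame_scale (tame_y j).
- exact: tame_cst.
- exact: tame_scale (tame_flow flowd_disp).
Qed.

Lemma iterD_action s :
  (forall p j, iterD s (fun p => action p.1 p.2) p ord0 j =
               iterD s (fun p => action p.1 p.2 ord0 j) p) /\
  (forall p, differentiable (iterD s (fun p => action p.1 p.2)) p).
Proof.
apply: iterD_coord => j s' p.
exact: tame_differentiable (tame_iterD s' (tame_action j)).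
Qed.

Lemma smooth_action_map : smooth (fun p : V => action p.1 p.2).
Proof. by move=> s p; have [] := iterD_action s. Qed.

Lemma oneDnorm_le_enorm (x : 'rV[R]_n) : 1 + `|x ord0 i0| <= 2 * (1 + enorm x ^+ 2).
Proof.
rewrite /enorm sqr_sqrtr; last by apply: sumr_ge0 => i _; exact: sqr_ge0.
rewrite (bigD1 i0)//=.
have : 0 <= \sum_(i < n | i != i0) x ord0 i ^+ 2 by apply: sumr_ge0 => i _; exact: sqr_ge0.
rewrite -(real_normK (num_real (x ord0 i0))).
have := sqr_ge0 (`|x ord0 i0| - 2^-1).
by have := normr_ge0 (x ord0 i0); nra.
Qed.

(** The coordinates of the action have grade 0 and [x]-derivatives preserve it, so the exponent
    depends only on the number of [y]-derivatives. Summing the constants over [j] makes the bound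
    uniform in the coordinate. *)
Lemma action_bound_box (mu : multi_index n) l : exists2 c : R, 0 < c &
  forall (x y : 'rV[R]_n) (nu : multi_index n) j, box y -> (order_mi nu <= l)%N ->
  `|dydx action nu mu x y ord0 j| <= c * (1 + enorm x ^+ 2) ^+ (3 * l).
Proof.
pose D j := iterD (map (@dirx R n) (mi_seq mu)) (fun p => action p.1 p.2 ord0 j).
have DT j : tame 0 (D j).
  apply: tame_iterDx (tame_action j) _.
  by apply/allP => _ /mapP[i _ ->] /=.
have /choice[C CP] j : exists C : R, 0 < C /\
    forall s : seq 'I_n, (size s <= l)%N -> forall p, box p.2 ->
    `|iterD (map (@diry R n) s) (D j) p| <= C * (1 + `|p.1 ord0 i0|) ^+ (3 * l).
  by have [C C0 HC] := tame_iterDy_bound l (DT j); exists C; rewrite addn0 in HC.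
have S0 : 0 <= \sum_j C j by apply: sumr_ge0 => j _; have [/ltW] := CP j.
exists ((1 + \sum_j C j) * 2 ^+ (3 * l)); first by rewrite mulr_gt0 ?exprn_gt0// ltr_pwDl.
move=> x y nu j yb nul.
rewrite /dydx -iterD_cat (iterD_action _).1 iterD_cat !mi_dirsE.
have [C0 HC] := CP j.
apply: le_trans (HC _ _ (x, y) yb) _; first by rewrite size_mi_seq.
rewrite -mulrA -exprMn; apply: ler_pM.
- exact: ltW.
- by rewrite exprn_ge0// addr_ge0.
- rewrite (bigD1 j)//= addrCA lerDl addr_ge0//.
  by apply: sumr_ge0 => i _; have [/ltW] := CP i.
- apply: lerXn2r; rewrite ?nnegrE ?addr_ge0//; last exact: oneDnorm_le_enorm.
  by rewrite mulr_ge0// addr_ge0// sqr_ge0.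
Qed.

(** * Group law, support and non-triviality *)

Lemma time_action x x' y : time (x, action x' y) = time (x, y).
Proof.
rewrite /time /rho /=; congr (_ * cutoff _); apply: eq_bigr => i ii0.
by rewrite /ycoord /action /= !mxE eqxx /= (negbTE ii0) mulr0 addr0.
Qed.

Lemma ycoord_action x y :
  ycoord i0 (x, action x y) = ycoord i0 (x, y) + disp (time (x, y)) (ycoord i0 (x, y)).
Proof.
rewrite {1}/ycoord /action /= !mxE !eqxx /= mulr1 addrAC mulrDl; congr (_ + _).
by rewrite mulrAC divff ?mul1r// gt_eqF.
Qed.

(** Only the coordinate [i0] moves, and [time] depends on [y] through the others: it is constant
    along orbits. As it is also additive in [x], the claim reduces to [dispD]. *)
Lemma actionD x x' y : action x (action x' y) = action (x + x') y.
Proof.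
rewrite /action -/(action x' y) time_action.
have -> : ycoord i0 (x, action x' y) = ycoord i0 (x', action x' y) by [].
rewrite ycoord_action {1}/action -addrA -scalerDl -mulrDr; congr (_ + (_ * _) *: _).
have -> : time (x + x', y) = time (x, y) + time (x', y).
  by rewrite /time /= mxE mulrDl.
by rewrite -dispD.
Qed.

Lemma action0 y : action 0 y = y.
Proof. by rewrite /action /time /= mxE mul0r disp0 mulr0 scale0r addr0. Qed.

(** The half-side [2 * r] of the box is chosen because [pi / 2 < 2]. Outside, some rescaled
    coordinate exceeds 2 in absolute value: if it is the one of index [i0], the displacement
    vanishes; otherwise [rho > 4], so [cutoff] vanishes and the flow time is 0. *)
Lemma action_out x y : ~ box y -> action x y = y.
Proof.
move=> yb; rewrite /action (_ : disp _ _ = 0) ?mulr0 ?scale0r ?addr0//.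
have p2 : pi / 2 <= 2 :> R by exact: ltW (pihalf_lt2 _).
have /existsNP[i /negP] := yb; rewrite -ltNge => yi.
have Yi : 2 < `|ycoord i (x, y)|.
  by rewrite /ycoord normrM normfV (gtr0_norm r_gt0) ltr_pdivlMr.
have [ii0|ii0] := eqVneq i i0.
  by rewrite ii0 in Yi; apply: disp_out; rewrite (le_trans p2)// ltW.
rewrite /time cutoff_out ?mulr0 ?disp0//.
rewrite (le_trans p2)// (le_trans _ (ler_norm _))// /rho (bigD1 i)//=.
have : 0 <= \sum_(j < n | (j != i0) && (j != i)) ycoord j (x, y) ^+ 2.
  by apply: sumr_ge0 => j _; exact: sqr_ge0.
rewrite -(real_normK (num_real (ycoord i (x, y)))).
by nra.
Qed.

Lemma compact_box : compact box.
Proof.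
have -> : box = [set y : 'rV[R]_n | forall i, `[y0 ord0 i - 2 * r, y0 ord0 i + 2 * r]%classic (y ord0 i)].
  apply/seteqP; split=> y yb i; have := yb i; rewrite /= in_itv /= ler_distl//.
apply: (rV_compact (A := fun i => `[y0 ord0 i - 2 * r, y0 ord0 i + 2 * r]%classic)) => i.
exact: segment_compact.
Qed.

(** At the centre all rescaled coordinates are 0 and [cutoff] is 1, so the flow runs for time 1 from
    the origin, which [disp10] shows to move. *)
Lemma action_nontrivial : action (delta_mx ord0 i0) y0 <> y0.
Proof.
rewrite /action => /eqP; rewrite -subr_eq0 addrAC subrr add0r scaler_eq0.
have -> : time (delta_mx ord0 i0, y0) = 1.
  rewrite /time /= !mxE !eqxx mul1r (_ : rho _ = 0) ?cutoff0//.
  by rewrite /rho big1// => i _; rewrite /ycoord subrr mul0r expr0n.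
rewrite /ycoord subrr mul0r mulf_eq0 gt_eqF//= (negbTE disp10) /=.
move=> /eqP/rowP/(_ i0); rewrite !mxE !eqxx => /eqP.
by rewrite oner_eq0.
Qed.

Lemma smooth_action_box : smooth_action box (fun l => (6 * l)%:R) action.
Proof.
split.
- exact: smooth_action_map.
- exact: action0.
- exact: actionD.
- exact: action_out.
- move=> mu l; have [c c0 H] := action_bound_box mu l; exists c => // x.
  apply: ge_ereal_sup => _ [y [nu [j [yb nul ->]]]]; rewrite lee_fin.
  apply: le_trans (H x y nu j yb nul) _; rewrite ler_pM2l//.
  (* With [b l = 6 l] the real exponent [b l / 2] is the natural number [3 l]. *)
  rewrite (_ : 2^-1 * _ = (3 * l)%:R) ?powR_mulrn ?addr_ge0 ?sqr_ge0//.
  by rewrite (_ : (6 * l = 2 * (3 * l))%N) ?natrM ?mulKf// mulnA.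
Qed.

End action.

Theorem theorem5p8 (R : realType) (n : nat) (hn : (0 < n)%N)
    (K : set 'rV[R]_n) (Kopen : open K) (Kne : K !=set0) :
  exists (K' : set 'rV[R]_n) (b : nat -> R)
      (tau : 'rV[R]_n -> 'rV[R]_n -> 'rV[R]_n),
    [/\ compact K' /\ K' `<=` K,
        (forall l, 0 <= b l) /\ b 0%N = 0,
        smooth_action K' b tau
      & exists x y : 'rV[R]_n, tau x y <> y].
Proof.
have [y0 Ky0] := Kne.
have /nbhs_ballP[e /= e0 eK] : nbhs y0 K by exact: open_nbhs_nbhs.
(* For [r = e / 4] the box has half-side [e / 2], so it lies in the sup-norm ball of radius [e]. *)
have r0 : 0 < e / 4 by rewrite divr_gt0.
exists (box y0 (e / 4)), (fun l => (6 * l)%:R), (action y0 (e / 4) (Ordinal hn)).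
split.
- split; first exact: compact_box.
  move=> y yb; apply: eK; split=> // i j; rewrite (ord1 i) /ball /= distrC.
  by apply: le_lt_trans (yb j) _; lra.
- by split=> [l|]; [exact: ler0n|rewrite muln0].
- exact: smooth_action_box.
- by exists (delta_mx ord0 (Ordinal hn)), y0; exact: action_nontrivial.
Qed.
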